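(* Let $G$ be a finitely generated, non-elementary, Gromov hyperbolic group and let $\phi: G\to G$ be a hyperbolic automorphism. Then the Reidemeister number $R(\phi)$ is infinite.
   Context: For an endomorphism $\phi:G\to G$, two elements $\alpha,\alpha'\in G$ are called $\phi$-conjugate if there exists $\gamma\in G$ with $\alpha'=\gamma\alpha\phi(\gamma)^{-1}$; the Reidemeister number $R(\phi)\in\mathbb{N}\cup\{\infty\}$ is the number of $\phi$-conjugacy classes. A group is non-elementary if it is not virtually cyclic. Fix a word metric $\|\cdot\|$ on $G$ with respect to a finite generating set. An automorphism $\phi$ of $G$ is hyperbolic if there exist an integer $m\ge 1$ and a real number $\lambda>1$ such that for all $g\in G$, $\max(\|\phi^m(g)\|,\|\phi^{-m}(g)\|)\ge\lambda\|g\|$. *)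

(* Defs.v *)
From Stdlib Require Import Reals Lra Lia List ZArith ClassicalEpsilon.
Import ListNotations.
Open Scope R_scope.

Section GroupDefs.
Context {G : Type} (mul : G -> G -> G) (one : G) (inv : G -> G).

Record is_group : Prop := {
  mul_assoc : forall x y z, mul x (mul y z) = mul (mul x y) z;
  mul_1l : forall x, mul one x = x;
  mul_1r : forall x, mul x one = x;
  mul_Vl : forall x, mul (inv x) x = one;
  mul_Vr : forall x, mul x (inv x) = one }.

Definition prodw (w : list G) : G := fold_right mul one w.

Definition is_letter (S : list G) (s : G) : Prop := In s S \/ In (inv s) S.

Definition generates (S : list G) : Prop :=
  forall g, exists w, Forall (is_letter S) w /\ g = prodw w.

Definition word_le (S : list G) (g : G) (n : nat) : Prop :=
  exists w, (length w <= n)%nat /\ Forall (is_letter S) w /\ g = prodw w.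

Definition wordlen (S : list G) (g : G) : nat :=
  epsilon (inhabits 0%nat)
    (fun n => word_le S g n /\ forall k, word_le S g k -> (n <= k)%nat).

Definition wdist (S : list G) (x y : G) : R := INR (wordlen S (mul (inv x) y)).

Definition gromov_prod (S : list G) (x y w : G) : R :=
  (wdist S x w + wdist S y w - wdist S x y) / 2.

Definition gromov_hyperbolic (S : list G) : Prop :=
  exists delta : R, forall x y z w,
    gromov_prod S x z w >= Rmin (gromov_prod S x y w) (gromov_prod S y z w) - delta.

Definition zpow (h : G) (n : Z) : G :=
  match n with
  | Z0 => one
  | Zpos p => Nat.iter (Pos.to_nat p) (mul h) one
  | Zneg p => Nat.iter (Pos.to_nat p) (mul (inv h)) one
  end.

(* virtually cyclic: some cyclic subgroup <h> has finite index,
   i.e. finitely many left cosets r<h> cover G *)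
Definition virtually_cyclic : Prop :=
  exists (h : G) (reps : list G),
    forall g, exists r, In r reps /\ exists n : Z, g = mul r (zpow h n).

Definition non_elementary : Prop := ~ virtually_cyclic.

Definition is_hom (phi : G -> G) : Prop :=
  forall x y, phi (mul x y) = mul (phi x) (phi y).

Definition twisted_conj (phi : G -> G) (a a' : G) : Prop :=
  exists gam, a' = mul (mul gam a) (inv (phi gam)).

Definition reidemeister_infinite (phi : G -> G) : Prop :=
  ~ exists reps : list G, forall a, exists r, In r reps /\ twisted_conj phi a r.

(* hyperbolic automorphism (phi with inverse psi) *)
Definition hyperbolic_aut (S : list G) (phi psi : G -> G) : Prop :=
  exists (m : nat) (lam : R), (1 <= m)%nat /\ 1 < lam /\
    forall g, Rmax (INR (wordlen S (Nat.iter m phi g)))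
                   (INR (wordlen S (Nat.iter m psi g)))
              >= lam * INR (wordlen S g).

End GroupDefs.

(* Main.v *)
(** If [phi] has finitely many twisted classes, then for some [N] every map [x -> a phi(x)]
    moves some point [y] by at most [N]; hyperbolicity of [phi] bounds [|y|] by a multiple
    of [|a|]. It remains to find [a] violating this.

    Bi-Lipschitz maps preserve Gromov products up to a factor and a sublinear error (a weak
    Morse lemma).
    Take [x] and [w] of comparable large length [n], [x] expanded by [phi] and contracted
    by [psi] for a long time, [w] the other way round. Points contracted in opposite
    directions have Gromov product [o(n)], because an element contracted both ways is short.
    Hence for [a = x w] there is no backtracking at [a] along [1, a, a phi(a)], and this is
    transported along the orbit of [1] under [x -> a phi(x)]. An almost fixed [y] then lies
    beyond every forward or beyond every backward iterate of [1], which makes [|y|] larger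
    than [|phi^K(a)|] or [|psi^K(a)|], both huge multiples of [|a|]. *)

Require Import Defs.
From Stdlib Require Import Reals List.
From Stdlib Require Import Lra Lia ZArith Classical ClassicalEpsilon.
Import ListNotations.
Open Scope R_scope.

(** * Elementary estimates: exponential against linear growth, iterates, error bookkeeping *)

Lemma INR_floor (r : R) : 0 <= r -> exists q : nat, INR q <= r < INR q + 1.
Proof.
intros Hr.
exists (Z.to_nat (up r - 1)).
destruct (archimed r) as [H1 H2].
assert (Hz : (0 < up r)%Z) by (apply lt_IZR; lra).
rewrite INR_IZR_INZ, Z2Nat.id by lia.
rewrite minus_IZR; lra.
Qed.

Lemma sqr_le_pow2 (k : nat) : ((k + 1) * (k + 1) <= 4 * 2 ^ k)%nat.
Proof.
(* The second conjunct bounds the increment [2 * k + 3] of the square, which the induction needs. *)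
enough (H : ((k + 1) * (k + 1) <= 4 * 2 ^ k /\ 2 * k + 3 <= 4 * 2 ^ k)%nat)
  by apply H.
induction k as [|k IH]; [simpl; lia|].
rewrite Nat.pow_succ_r'; lia.
Qed.

Lemma linear_le_pow2 (D : R) :
  exists k0 : nat, forall k, (k0 <= k)%nat -> D * (INR k + 1) <= 2 ^ k.
Proof.
destruct (INR_floor (Rmax 0 (4 * D))) as [k0 Hk0]; [apply Rmax_l|].
exists k0; intros k Hk.
assert (H4D := Rmax_r 0 (4 * D)).
apply le_INR in Hk.
assert (Hs := sqr_le_pow2 k).
apply le_INR in Hs.
rewrite !mult_INR, plus_INR, pow_INR in Hs.
replace (INR 4) with 4 in Hs by (simpl; lra).
replace (INR 2) with 2 in Hs by (simpl; lra).
replace (INR 1) with 1 in Hs by (simpl; lra).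
assert (H0 := pos_INR k).
nra.
Qed.

(** Source of the sublinear errors: a path of length [A * n] has only logarithmically many dyadic
    scales. The proof takes [k] as large as the second inequality allows and lets the exponential
    win in the first. *)
Lemma linear_le_pow2_sublinear (A B eps : R) : 0 < A -> 0 < B -> 0 < eps ->
  exists n0, forall n, n0 <= n ->
    exists k : nat, A * n <= 2 ^ k /\ B * (INR k + 1) <= eps * n.
Proof.
intros HA HB He.
destruct (linear_le_pow2 (2 * (A * B / eps))) as [k0 Hk0].
exists ((INR k0 + 2) * B / eps).
intros n Hn.
assert (Hr : INR k0 + 2 <= eps * n / B).
{ apply (Rmult_le_reg_r B); [lra|].
  replace (eps * n / B * B) with (eps * n) by (field; lra).
  apply (Rmult_le_compat_l eps) in Hn; [|lra].
  replace (eps * ((INR k0 + 2) * B / eps)) with ((INR k0 + 2) * B) in Hn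
    by (field; lra).
  exact Hn. }
assert (H0 := pos_INR k0).
destruct (INR_floor (eps * n / B)) as [q [Hq1 Hq2]]; [lra|].
destruct q as [|k]; [simpl in Hq2; lra|].
rewrite S_INR in Hq1, Hq2.
exists k; split.
- assert (Hk : (k0 <= k)%nat) by (apply INR_le; lra).
  specialize (Hk0 k Hk).
  replace (A * n) with (A * B / eps * (eps * n / B)) by (field; lra).
  assert (0 < A * B / eps)
    by (apply Rdiv_lt_0_compat; [apply Rmult_lt_0_compat|]; lra).
  assert (H1 := pos_INR k).
  nra.
- apply (Rmult_le_compat_l B) in Hq1; [|lra].
  replace (B * (eps * n / B)) with (eps * n) in Hq1 by (field; lra).
  exact Hq1.
Qed.

Lemma pow_unbounded (lam b : R) : 1 < lam -> exists j : nat, b <= lam ^ j.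
Proof.
intros Hl.
destruct (Pow_x_infinity lam ltac:(rewrite Rabs_right; lra) b) as [j Hj].
exists j. specialize (Hj j (le_n j)).
rewrite Rabs_right in Hj; [lra|].
apply Rle_ge, pow_le; lra.
Qed.

Lemma nat_last_before (P : nat -> Prop) (J K : nat) :
  P J -> (J <= K)%nat -> ~ P K -> exists k, (J <= k)%nat /\ P k /\ ~ P (S k).
Proof.
intros HJ HJK; induction HJK as [|K HJK IH]; intros HK; [contradiction|].
destruct (classic (P K)) as [HP|HP]; [exists K; auto|auto].
Qed.

Lemma iter_mul (A : Type) (f : A -> A) (j m : nat) (x : A) :
  Nat.iter j (Nat.iter m f) x = Nat.iter (j * m) f x.
Proof.
induction j as [|j IH]; [reflexivity|].
simpl. rewrite IH. symmetry; apply Nat.iter_add.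
Qed.

Lemma iter_cancel (A : Type) (f f' : A -> A) (j : nat) (x : A) :
  (forall y, f' (f y) = y) -> Nat.iter j f' (Nat.iter j f x) = x.
Proof.
intros Hc; induction j as [|j IH]; [reflexivity|].
rewrite Nat.iter_succ_r, Nat.iter_succ, Hc; exact IH.
Qed.

Lemma iter_commute (A : Type) (f g : A -> A) (j : nat) (x : A) :
  (forall y, f (g y) = g (f y)) -> Nat.iter j f (g x) = g (Nat.iter j f x).
Proof.
intros Hc; induction j as [|j IH]; [reflexivity|].
rewrite !Nat.iter_succ, IH; apply Hc.
Qed.

(** Common bound for the error terms of [almost_fixed_beyond], with [k] standing for [INR K + 1] and
    [P] for [L ^ K]. The first is the error for [phi]; the second is the one for [psi], after the
    losses of [almost_fixed_behind] and [almost_fixed_inverse]. *)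
Lemma total_error_le (k P L X N t : R) :
  0 <= k -> 1 <= P -> 1 <= L -> 0 <= X -> 0 <= N -> 0 <= t ->
  k * (2 * (P * X + t) + P * N) <= k * 5 * P * L ^ 2 * (X + N + t) /\
  k * (2 * (P * (L ^ 2 * (X + N) + t + L * N) + t) + P * (L * N))
  <= k * 5 * P * L ^ 2 * (X + N + t).
Proof.
intros Hk HP HL HX HN Ht.
assert (HPL : P <= P * L) by nra.
assert (HPL2 : P * L <= P * L ^ 2) by nra.
assert (Hmul : forall c c' u, c <= c' -> 0 <= u -> c * u <= c' * u)
  by (intros; apply Rmult_le_compat_r; auto).
assert (H1 := Hmul (P * L) (P * L ^ 2) N HPL2 HN).
assert (H2 := Hmul P (P * L ^ 2) t ltac:(lra) Ht).
assert (H3 := Hmul 1 (P * L ^ 2) t ltac:(lra) Ht).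
assert (H4 := Hmul P (P * L ^ 2) N ltac:(lra) HN).
assert (H5 := Hmul P (P * L ^ 2) X ltac:(lra) HX).
assert (H6 := Hmul 0 P X ltac:(lra) HX).
assert (H7 := Hmul 0 P N ltac:(lra) HN).
assert (H8 := Hmul 0 P t ltac:(lra) Ht).
replace (k * 5 * P * L ^ 2 * (X + N + t))
  with (k * (5 * (P * L ^ 2 * X + P * L ^ 2 * N + P * L ^ 2 * t))) by ring.
split; (apply Rmult_le_compat_l; [exact Hk|]); lra.
Qed.

(** * Group identities, the word metric and discrete geodesics *)

Section WordMetric.

Context {G : Type} (mul : G -> G -> G) (one : G) (inv : G -> G) (S : list G).
Context (HG : is_group mul one inv) (Hgen : generates mul one inv S).

Local Notation "x ** y" := (mul x y) (at level 40, left associativity).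
Local Notation nrm x := (INR (wordlen mul one inv S x)).
Local Notation dist := (wdist mul one inv S).
Local Notation gprod := (gromov_prod mul one inv S).

Lemma mul_cancel_l x y z : x ** y = x ** z -> y = z.
Proof.
intros H.
rewrite <- (mul_1l _ _ _ HG y), <- (mul_1l _ _ _ HG z), <- (mul_Vl _ _ _ HG x).
rewrite <- !(mul_assoc _ _ _ HG), H; reflexivity.
Qed.

Lemma inv_unique x y : x ** y = one -> y = inv x.
Proof.
intros H; apply (mul_cancel_l x); rewrite H, (mul_Vr _ _ _ HG); reflexivity.
Qed.

Lemma inv_inv x : inv (inv x) = x.
Proof. symmetry; apply inv_unique, (mul_Vl _ _ _ HG). Qed.

Lemma inv_one : inv one = one.
Proof. symmetry; apply inv_unique, (mul_1l _ _ _ HG). Qed.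

Lemma mul_assoc_r x y z : (x ** y) ** z = x ** (y ** z).
Proof. symmetry; apply (mul_assoc _ _ _ HG). Qed.

Lemma mulKg x y : inv x ** (x ** y) = y.
Proof. rewrite (mul_assoc _ _ _ HG), (mul_Vl _ _ _ HG); apply (mul_1l _ _ _ HG). Qed.

Lemma mulKVg x y : x ** (inv x ** y) = y.
Proof. rewrite (mul_assoc _ _ _ HG), (mul_Vr _ _ _ HG); apply (mul_1l _ _ _ HG). Qed.

Lemma inv_mul x y : inv (x ** y) = inv y ** inv x.
Proof.
symmetry; apply inv_unique.
rewrite mul_assoc_r, mulKVg; apply (mul_Vr _ _ _ HG).
Qed.

Ltac gsimp :=
  repeat first
    [ rewrite inv_mul | rewrite inv_inv | rewrite inv_one
    | rewrite mul_assoc_r | rewrite mulKg | rewrite mulKVg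
    | rewrite (mul_Vl _ _ _ HG) | rewrite (mul_Vr _ _ _ HG)
    | rewrite (mul_1l _ _ _ HG) | rewrite (mul_1r _ _ _ HG) ].

Lemma prodw_app u v : prodw mul one (u ++ v) = prodw mul one u ** prodw mul one v.
Proof.
induction u as [|s u IH]; simpl; [now rewrite (mul_1l _ _ _ HG)|].
rewrite IH; apply (mul_assoc _ _ _ HG).
Qed.

Lemma prodw_rev_inv w : prodw mul one (rev (map inv w)) = inv (prodw mul one w).
Proof.
induction w as [|s w IH]; simpl; [now rewrite inv_one|].
rewrite prodw_app, IH; simpl; now gsimp.
Qed.

Lemma wordlen_spec g :
  word_le mul one inv S g (wordlen mul one inv S g) /\
  forall k, word_le mul one inv S g k -> (wordlen mul one inv S g <= k)%nat.
Proof.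
unfold wordlen.
apply (epsilon_spec (inhabits 0%nat)
  (fun n => word_le mul one inv S g n /\
    forall k, word_le mul one inv S g k -> (n <= k)%nat)).
destruct (Hgen g) as [w [Hw Hg]].
assert (H0 : exists n, word_le mul one inv S g n) by (exists (length w), w; auto).
destruct (Wf_nat.dec_inh_nat_subset_has_unique_least_element
  (word_le mul one inv S g) (fun n => classic _) H0) as [n [Hn _]].
exists n; exact Hn.
Qed.

Lemma nrm_prodw w :
  Forall (is_letter inv S) w -> nrm (prodw mul one w) <= INR (length w).
Proof.
intros Hw; apply le_INR, (proj2 (wordlen_spec _)).
exists w; auto.
Qed.

Lemma geodesic_word g : exists w, Forall (is_letter inv S) w /\
  g = prodw mul one w /\ INR (length w) = nrm g.
Proof.
destruct (wordlen_spec g) as [[w [Hl [Hw Hg]]] _].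
exists w; repeat split; auto.
apply Rle_antisym; [now apply le_INR|].
rewrite Hg at 1; now apply nrm_prodw.
Qed.

Lemma nrm_one : nrm one = 0.
Proof.
apply Rle_antisym; [|apply pos_INR].
exact (nrm_prodw [] (Forall_nil _)).
Qed.

Lemma nrm_ge1 g : g <> one -> 1 <= nrm g.
Proof.
intros Hg.
destruct (geodesic_word g) as [[|s w] [_ [E <-]]]; [contradiction|].
simpl length; rewrite S_INR; assert (H := pos_INR (length w)); lra.
Qed.

Lemma nrm_mul g h : nrm (g ** h) <= nrm g + nrm h.
Proof.
destruct (geodesic_word g) as [u [Hu [Eg <-]]].
destruct (geodesic_word h) as [v [Hv [Eh <-]]].
rewrite Eg, Eh, <- prodw_app, <- plus_INR, <- length_app.
apply nrm_prodw, Forall_app; auto.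
Qed.

Lemma nrm_inv_le g : nrm (inv g) <= nrm g.
Proof.
destruct (geodesic_word g) as [w [Hw [Eg <-]]].
rewrite Eg, <- prodw_rev_inv, <- (length_map inv w), <- length_rev.
apply nrm_prodw, Forall_rev, Forall_map.
apply (Forall_impl _ (P := is_letter inv S)); [|exact Hw].
intros s [Hs|Hs]; [right; now rewrite inv_inv|now left].
Qed.

Lemma nrm_inv g : nrm (inv g) = nrm g.
Proof.
apply Rle_antisym; [apply nrm_inv_le|].
rewrite <- (inv_inv g) at 1; apply nrm_inv_le.
Qed.

Lemma dist_ge0 x y : 0 <= dist x y.
Proof. apply pos_INR. Qed.

Lemma dist_sym x y : dist x y = dist y x.
Proof. unfold wdist; rewrite <- nrm_inv; now gsimp. Qed.

Lemma dist_triangle x y z : dist x z <= dist x y + dist y z.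
Proof.
unfold wdist.
replace (inv x ** z) with ((inv x ** y) ** (inv y ** z)) by now gsimp.
apply nrm_mul.
Qed.

Lemma dist_mul_l g x y : dist (g ** x) (g ** y) = dist x y.
Proof. unfold wdist; now gsimp. Qed.

Lemma dist_one_l x : dist one x = nrm x.
Proof. unfold wdist; now gsimp. Qed.

Lemma dist_one_r x : dist x one = nrm x.
Proof. rewrite dist_sym; apply dist_one_l. Qed.

Lemma gprod_mul_l g x y z : gprod (g ** x) (g ** y) (g ** z) = gprod x y z.
Proof. unfold gromov_prod; now rewrite !dist_mul_l. Qed.

Lemma gprod_sym x y z : gprod x y z = gprod y x z.
Proof. unfold gromov_prod; rewrite (dist_sym x y); lra. Qed.

Lemma gprod_move x x' y z : gprod x y z <= gprod x' y z + dist x x'.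
Proof.
unfold gromov_prod.
assert (H1 := dist_triangle x x' z); assert (H2 := dist_triangle x' x y).
rewrite (dist_sym x' x) in H2; lra.
Qed.

Lemma geodesic_path x y : exists p : nat -> G,
  p 0%nat = x /\
  (forall i, dist x y <= INR i -> p i = y) /\
  (forall i, dist (p i) (p (i + 1)%nat) <= 1) /\
  (forall i, INR i <= dist x y -> dist x (p i) = INR i) /\
  (forall i, dist x (p i) + dist (p i) y = dist x y).
Proof.
destruct (geodesic_word (inv x ** y)) as [w [Hw [Ew Hl]]].
fold (dist x y) in Hl.
assert (Ey : y = x ** prodw mul one w) by (rewrite <- Ew; now gsimp).
exists (fun i => x ** prodw mul one (firstn i w)).
assert (Hpre : forall i, dist x (x ** prodw mul one (firstn i w))
                         <= INR (length (firstn i w))).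
{ intros i; unfold wdist; gsimp.
  apply nrm_prodw.
  rewrite <- (firstn_skipn i w) in Hw.
  apply Forall_app in Hw; tauto. }
assert (Hsuf : forall i, dist (x ** prodw mul one (firstn i w)) y
                         <= INR (length (skipn i w))).
{ intros i.
  assert (Es : prodw mul one w
               = prodw mul one (firstn i w) ** prodw mul one (skipn i w))
    by (rewrite <- prodw_app, firstn_skipn; reflexivity).
  rewrite Ey, Es, dist_mul_l; unfold wdist; gsimp.
  apply nrm_prodw.
  rewrite <- (firstn_skipn i w) in Hw; apply Forall_app in Hw; tauto. }
assert (El : forall i,
  INR (length w) = INR (length (firstn i w)) + INR (length (skipn i w)))
  by (intros i; rewrite <- plus_INR, <- length_app, firstn_skipn; reflexivity).
repeat split.
- simpl; now gsimp.
- intros i Hi; rewrite <- Hl in Hi; apply INR_le in Hi.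
  rewrite firstn_all2 by exact Hi; now rewrite Ey.
- intros i; rewrite dist_mul_l; unfold wdist.
  assert (E : firstn (i + 1) w = firstn i w ++ firstn 1 (skipn i w)).
  { rewrite <- (firstn_skipn i w) at 1.
    rewrite firstn_app.
    destruct (Nat.le_gt_cases i (length w)) as [Hi|Hi].
    - rewrite firstn_all2 by (rewrite length_firstn; lia).
      rewrite length_firstn, Nat.min_l by exact Hi.
      do 2 f_equal; lia.
    - rewrite (firstn_all2 (n := i)) by lia.
      rewrite (skipn_all2 (n := i)) by lia.
      rewrite !firstn_nil, firstn_all2 by lia; reflexivity. }
  rewrite E, prodw_app; gsimp.
  apply Rle_trans with (INR (length (firstn 1 (skipn i w)))).
  + apply nrm_prodw.
    rewrite <- (firstn_skipn i w) in Hw; apply Forall_app in Hw.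
    destruct Hw as [_ Hw].
    rewrite <- (firstn_skipn 1 (skipn i w)) in Hw; apply Forall_app in Hw; tauto.
  + apply (le_INR _ 1); rewrite length_firstn; lia.
- intros i Hi; specialize (Hpre i); specialize (Hsuf i); specialize (El i).
  assert (Hi' : (i <= length w)%nat) by (apply INR_le; lra).
  rewrite length_firstn, Nat.min_l in * by exact Hi'.
  assert (H := dist_triangle x (x ** prodw mul one (firstn i w)) y); lra.
- intros i; specialize (Hpre i); specialize (Hsuf i); specialize (El i).
  assert (H := dist_triangle x (x ** prodw mul one (firstn i w)) y); lra.
Qed.

(** * Gromov products under bi-Lipschitz maps *)

Context (delta : R).
Context (Hdelta : forall x y z w,
  gprod x z w >= Rmin (gprod x y w) (gprod y z w) - delta).

Lemma delta_ge0 : 0 <= delta.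
Proof.
assert (H := Hdelta one one one one).
rewrite Rmin_left in H by lra; lra.
Qed.

Lemma gprod_four_point x y z w :
  gprod x y w <= gprod x z w + delta \/ gprod y z w <= gprod x z w + delta.
Proof.
assert (H := Hdelta x y z w).
unfold Rmin in H; destruct (Rle_dec (gprod x y w) (gprod y z w)); [left|right]; lra.
Qed.

(** Bisecting the path costs one [delta] per halving, so [2 ^ k] steps cost only [k * delta]. *)
Lemma gprod_chain (z : G) (k : nat) : forall p : nat -> G, exists i,
  gprod (p i) (p (i + 1)%nat) z <= gprod (p 0%nat) (p (2 ^ k)%nat) z + INR k * delta.
Proof.
induction k as [|k IH]; intros p.
- exists 0%nat; simpl; lra.
- rewrite S_INR, Nat.pow_succ_r'.
  destruct (gprod_four_point (p 0%nat) (p (2 ^ k)%nat) (p (2 * 2 ^ k)%nat) z) as [H|H].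
  + destruct (IH p) as [i Hi]; exists i; lra.
  + destruct (IH (fun i => p (2 ^ k + i)%nat)) as [i Hi].
    exists (2 ^ k + i)%nat; cbv beta in Hi.
    replace (2 ^ k + 2 ^ k)%nat with (2 * 2 ^ k)%nat in Hi by lia.
    rewrite Nat.add_0_r, Nat.add_assoc in Hi; lra.
Qed.

Definition bilipschitz (Lam : R) (f f' : G -> G) : Prop :=
  (forall x y, dist (f x) (f y) <= Lam * dist x y) /\
  (forall x y, dist (f' x) (f' y) <= Lam * dist x y) /\
  (forall x, f' (f x) = x) /\ (forall x, f (f' x) = x).

(* The image under [f'] of a geodesic from [f x] to [f y] is a path from [x] to [y] with
   jumps at most [Lam]; by [gprod_chain] it passes near [z] if [gprod x y z] is small. *)
Lemma gprod_bilipschitz_pow2 (Lam : R) (f f' : G -> G) (k : nat) (x y z : G) :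
  0 <= Lam -> bilipschitz Lam f f' -> Lam * dist x y <= 2 ^ k ->
  gprod (f x) (f y) (f z) <= Lam * (gprod x y z + INR k * delta + Lam).
Proof.
intros HLam [Hf [Hf' [Hc Hc']]] Hk.
destruct (geodesic_path (f x) (f y)) as [p [Hp0 [Hpe [Hp1 [_ Hpg]]]]].
assert (Ek : p (2 ^ k)%nat = f y).
{ apply Hpe; rewrite pow_INR; replace (INR 2) with 2 by (simpl; lra).
  eapply Rle_trans; [apply Hf|exact Hk]. }
destruct (gprod_chain z k (fun i => f' (p i))) as [i Hi]; cbv beta in Hi.
rewrite Hp0, Ek, !Hc in Hi.
assert (Hs : dist (f' (p i)) (f' (p (i + 1)%nat)) <= Lam).
{ eapply Rle_trans; [apply Hf'|].
  rewrite <- (Rmult_1_r Lam) at 2; apply Rmult_le_compat_l; auto. }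
assert (Hz : dist (f' (p i)) z <= gprod x y z + INR k * delta + Lam).
{ unfold gromov_prod in Hi at 1.
  assert (H := dist_triangle (f' (p i)) (f' (p (i + 1)%nat)) z); lra. }
assert (Hq : dist (p i) (f z) <= Lam * (gprod x y z + INR k * delta + Lam)).
{ rewrite <- (Hc' (p i)) at 1.
  eapply Rle_trans; [apply Hf|]; now apply Rmult_le_compat_l. }
unfold gromov_prod at 1.
specialize (Hpg i).
assert (H1 := dist_triangle (f x) (p i) (f z)).
assert (H2 := dist_triangle (f y) (p i) (f z)).
rewrite (dist_sym (f y) (p i)) in H2; lra.
Qed.

(** The term [k * delta] of [gprod_bilipschitz_pow2] is logarithmic in [n] and disappears in
    [eps * n]. The threshold depends on [Lam], [eps] and [C] only, not on the maps, so it serves all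
    iterates up to a fixed order at once. *)
Lemma gprod_bilipschitz (Lam eps C : R) : 1 <= Lam -> 0 < eps -> 0 < C ->
  exists n0, forall n, n0 <= n -> forall f f' x y z,
    bilipschitz Lam f f' -> dist x y <= C * n ->
    gprod (f x) (f y) (f z) <= Lam * gprod x y z + eps * n.
Proof.
intros HLam He HC.
assert (Hd := delta_ge0).
destruct (linear_le_pow2_sublinear (Lam * C) (Lam * (delta + Lam)) eps)
  as [n0 Hn0]; try nra.
exists n0; intros n Hn f f' x y z Hf Hxy.
destruct (Hn0 n Hn) as [k [Hk1 Hk2]].
assert (H := gprod_bilipschitz_pow2 Lam f f' k x y z ltac:(lra) Hf).
assert (Hk : Lam * dist x y <= 2 ^ k) by nra.
specialize (H Hk).
assert (H0 := pos_INR k).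
assert (0 <= INR k * Lam) by nra.
assert (Lam * (INR k * delta + Lam) <= Lam * (delta + Lam) * (INR k + 1)).
{ rewrite Rmult_assoc; apply Rmult_le_compat_l; [lra|].
  ring_simplify. assert (0 <= delta) by lra. lra. }
lra.
Qed.

(** * Hyperbolic automorphisms: expanded and contracted elements *)

(* [phi] and [psi] play symmetric roles, so that every statement below also applies to
   the inverse automorphism. *)
Record hyperbolic_pair (phi psi : G -> G) (L : R) (m : nat) (lam : R) : Prop := {
  hp_hom : is_hom mul phi;
  hp_hom' : is_hom mul psi;
  hp_can : forall g, psi (phi g) = g;
  hp_can' : forall g, phi (psi g) = g;
  hp_L : 1 <= L;
  hp_lip : forall g, nrm (phi g) <= L * nrm g;
  hp_lip' : forall g, nrm (psi g) <= L * nrm g;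
  hp_lam : 1 < lam;
  hp_exp : forall g, lam * nrm g <= nrm (Nat.iter m phi g) \/
                     lam * nrm g <= nrm (Nat.iter m psi g) }.

Lemma hyperbolic_pair_sym phi psi L m lam :
  hyperbolic_pair phi psi L m lam -> hyperbolic_pair psi phi L m lam.
Proof.
intros H; destruct H; split; auto.
intros g; destruct (hp_exp0 g); auto.
Qed.

Lemma hom_one f : is_hom mul f -> f one = one.
Proof.
intros Hf; apply (mul_cancel_l (f one)).
rewrite <- Hf; now gsimp.
Qed.

Lemma hom_inv f g : is_hom mul f -> f (inv g) = inv (f g).
Proof.
intros Hf; apply inv_unique.
rewrite <- Hf, (mul_Vr _ _ _ HG); now apply hom_one.
Qed.

Lemma hom_iter f j : is_hom mul f -> is_hom mul (Nat.iter j f).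
Proof.
intros Hf; induction j as [|j IH]; intros x y; [reflexivity|].
simpl; now rewrite IH, Hf.
Qed.

Lemma dist_hom f x y : is_hom mul f -> dist (f x) (f y) = nrm (f (inv x ** y)).
Proof. intros Hf; unfold wdist; now rewrite <- (hom_inv f x Hf), <- Hf. Qed.

Lemma nrm_iter_le f L j g : 0 <= L -> (forall h, nrm (f h) <= L * nrm h) ->
  nrm (Nat.iter j f g) <= L ^ j * nrm g.
Proof.
intros HL Hf; induction j as [|j IH]; simpl; [lra|].
eapply Rle_trans; [apply Hf|].
rewrite Rmult_assoc; now apply Rmult_le_compat_l.
Qed.

Lemma lipschitz_constant f : is_hom mul f ->
  exists L, 1 <= L /\ forall g, nrm (f g) <= L * nrm g.
Proof.
intros Hf.
assert (HS : forall T : list G, exists L, 1 <= L /\ forall s, In s T -> nrm (f s) <= L).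
{ induction T as [|t T [L [HL HT]]]; [exists 1; split; [lra|intros s []]|].
  exists (Rmax L (nrm (f t))); split.
  - eapply Rle_trans; [exact HL|apply Rmax_l].
  - intros s [<-|Hs]; [apply Rmax_r|].
    eapply Rle_trans; [now apply HT|apply Rmax_l]. }
destruct (HS S) as [L [HL HT]]; exists L; split; [exact HL|].
intros g; destruct (geodesic_word g) as [w [Hw [-> <-]]].
induction Hw as [|s w Hs Hw IH].
- simpl; rewrite hom_one, nrm_one by exact Hf; lra.
- simpl prodw; simpl length; rewrite Hf, S_INR.
  assert (nrm (f s) <= L).
  { destruct Hs as [Hs|Hs]; [now apply HT|].
    rewrite <- nrm_inv, <- hom_inv by exact Hf; now apply HT. }
  assert (H1 := nrm_mul (f s) (f (prodw mul one w))); lra.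
Qed.

Section HyperbolicPair.

Context {phi psi : G -> G} {L : R} {m : nat} {lam : R}.
Context (HP : hyperbolic_pair phi psi L m lam).

Local Notation F := (Nat.iter m phi).
Local Notation F' := (Nat.iter m psi).

Lemma bilipschitz_iter j K : (j <= K)%nat ->
  bilipschitz (L ^ K) (Nat.iter j phi) (Nat.iter j psi).
Proof.
intros Hj; destruct HP.
assert (Hpow : L ^ j <= L ^ K) by (apply Rle_pow; auto).
split; [|split; [|split]].
- intros x y; rewrite dist_hom by now apply hom_iter.
  eapply Rle_trans; [apply (nrm_iter_le phi L); auto; lra|].
  apply Rmult_le_compat_r; [apply pos_INR|exact Hpow].
- intros x y; rewrite dist_hom by now apply hom_iter.
  eapply Rle_trans; [apply (nrm_iter_le psi L); auto; lra|].
  apply Rmult_le_compat_r; [apply pos_INR|exact Hpow].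
- intros x; now apply iter_cancel.
- intros x; now apply iter_cancel.
Qed.

Lemma hp_powL_ge1 j : 1 <= L ^ j.
Proof. apply pow_R1_Rle, (hp_L _ _ _ _ _ HP). Qed.

Lemma iter_F_can x : F' (F x) = x.
Proof. apply iter_cancel, (hp_can _ _ _ _ _ HP). Qed.

(** Expansion persists: if the next iterate were instead expanded by [F'], going back one step would
    both lengthen and shorten it by the factor [lam], which forces norm 0. *)
Lemma expand_iter z : lam * nrm z <= nrm (F z) ->
  forall j, lam * nrm (Nat.iter j F z) <= nrm (Nat.iter (j + 1) F z).
Proof.
intros Hz j; assert (Hl := hp_lam _ _ _ _ _ HP).
induction j as [|j IH]; [exact Hz|].
rewrite !Nat.add_1_r in *.
destruct (hp_exp _ _ _ _ _ HP (Nat.iter (Datatypes.S j) F z)) as [H|H]; [exact H|].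
replace (F' (Nat.iter (Datatypes.S j) F z)) with (Nat.iter j F z) in H
  by (symmetry; apply iter_F_can).
assert (H0 := pos_INR (wordlen mul one inv S (Nat.iter j F z))).
assert (H1 := pos_INR (wordlen mul one inv S (Nat.iter (Datatypes.S j) F z))).
assert (E : nrm (Nat.iter (Datatypes.S j) F z) = 0) by nra.
rewrite E; rewrite Rmult_0_r; apply pos_INR.
Qed.

Lemma expand_pow z : lam * nrm z <= nrm (F z) ->
  forall j, lam ^ j * nrm z <= nrm (Nat.iter j F z).
Proof.
intros Hz j; assert (Hl := hp_lam _ _ _ _ _ HP).
induction j as [|j IH]; [simpl; lra|].
assert (H := expand_iter z Hz j); rewrite Nat.add_1_r in H.
eapply Rle_trans; [|exact H].
simpl pow; rewrite Rmult_assoc; apply Rmult_le_compat_l; lra.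
Qed.

(** Otherwise [F'] expands every nontrivial element. Going from [Nat.iter j F g] back to [g] then
    gives [lam ^ j <= nrm g] for all [j]. *)
Lemma exists_expanding g : g <> one ->
  exists h, h <> one /\ lam * nrm h <= nrm (F h).
Proof.
intros Hg; apply NNPP; intros Hn.
assert (Hall : forall h, h <> one -> lam * nrm h <= nrm (F' h)).
{ intros h Hh; destruct (hp_exp _ _ _ _ _ HP h) as [H|H]; [|exact H].
  exfalso; apply Hn; exists h; auto. }
assert (Hl := hp_lam _ _ _ _ _ HP).
assert (Hcan' : forall x, F (F' x) = x)
  by (intros x; apply iter_cancel, (hp_can' _ _ _ _ _ HP)).
assert (HF'1 : F' one = one) by (apply hom_one, hom_iter, (hp_hom' _ _ _ _ _ HP)).
assert (Hj : forall j h, h <> one ->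
             lam ^ j * nrm h <= nrm (Nat.iter j F' h) /\ Nat.iter j F' h <> one).
{ induction j as [|j IH]; intros h Hh; [simpl; split; [lra|exact Hh]|].
  destruct (IH h Hh) as [H1 H2]; simpl pow; simpl Nat.iter; split.
  - specialize (Hall _ H2).
    rewrite Rmult_assoc; eapply Rle_trans; [|exact Hall].
    apply Rmult_le_compat_l; lra.
  - intros E; apply H2; rewrite <- (Hcan' (Nat.iter j F' h)), E.
    apply hom_one, hom_iter, (hp_hom _ _ _ _ _ HP). }
destruct (pow_unbounded lam (nrm g + 1) Hl) as [j Hlj].
assert (HFg : Nat.iter j F g <> one).
{ intros E; apply Hg.
  rewrite <- (iter_cancel _ F F' j g iter_F_can), E.
  apply hom_one, hom_iter, hom_iter, (hp_hom' _ _ _ _ _ HP). }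
destruct (Hj j _ HFg) as [H _].
rewrite (iter_cancel _ F F' j g iter_F_can) in H.
assert (H1 := nrm_ge1 _ HFg).
assert (H2 := pos_INR (wordlen mul one inv S g)).
nra.
Qed.

(** The element is an iterate of an expanding [h], stopped at an index [k >= J] where the next
    iterate exceeds [n]; one step multiplies the norm by at most [L ^ m], whence the lower bound.
    Since [k >= J], the first [J] preimages are still iterates of [h], so going back contracts. *)
Lemma exists_expanding_scale g : g <> one -> forall J : nat,
  exists n0, forall n, n0 <= n -> exists x,
    n <= L ^ m * nrm x /\ nrm x <= n /\
    (forall i, (i <= J)%nat -> lam ^ i * nrm (Nat.iter i F' x) <= nrm x) /\
    (forall i, lam ^ i * nrm x <= nrm (Nat.iter i F x)).
Proof.
intros Hg J; assert (Hl := hp_lam _ _ _ _ _ HP).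
destruct (exists_expanding g Hg) as [h [Hh Hexp]].
exists (nrm (Nat.iter J F h)); intros n Hn.
destruct (pow_unbounded lam (n + 1) Hl) as [K HK].
assert (Hh1 := nrm_ge1 _ Hh).
assert (Hbig : forall k, (K <= k)%nat -> ~ nrm (Nat.iter k F h) <= n).
{ intros k Hk H; assert (H1 := expand_pow h Hexp k).
  assert (lam ^ K <= lam ^ k) by (apply Rle_pow; [lra|exact Hk]).
  assert (0 < lam ^ k) by (apply pow_lt; lra).
  nra. }
destruct (nat_last_before (fun k => nrm (Nat.iter k F h) <= n) J (Nat.max J K))
  as [k [HJk [Hk1 Hk2]]]; [exact Hn|lia|apply Hbig; lia|].
exists (Nat.iter k F h); repeat split.
- apply Rnot_le_lt in Hk2; simpl in Hk2.
  destruct HP.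
  assert (H := nrm_iter_le phi L m (Nat.iter k F h) ltac:(lra) hp_lip0); lra.
- exact Hk1.
- intros i Hi.
  replace k with (i + (k - i))%nat by lia.
  rewrite (Nat.iter_add i), (iter_cancel _ F F' i _ iter_F_can).
  apply expand_pow.
  assert (H := expand_iter h Hexp (k - i)).
  rewrite Nat.add_1_r in H; exact H.
- intros i; apply expand_pow.
  assert (H := expand_iter h Hexp k).
  rewrite Nat.add_1_r in H; exact H.
Qed.

End HyperbolicPair.

(** * Transversality of the two contracted directions *)

Lemma bilipschitz_sym Lam f f' : bilipschitz Lam f f' -> bilipschitz Lam f' f.
Proof. intros [H1 [H2 [H3 H4]]]; repeat split; auto. Qed.

Lemma nrm_le_gprod x z : nrm z <= nrm x + 2 * gprod one x z.
Proof.
unfold gromov_prod; rewrite !dist_one_l.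
assert (H := dist_ge0 x z); lra.
Qed.

Lemma gprod_ge0 x y z : 0 <= gprod x y z.
Proof.
unfold gromov_prod; assert (H := dist_triangle x z y).
rewrite (dist_sym z y) in H; lra.
Qed.

(* A point close to both geodesics from [1] to [p] and from [1] to [q] is contracted both
   by [psi^(J m)] and by [phi^(J m)], which hyperbolicity only allows near [1]. *)
Lemma transverse phi psi L m lam (J : nat) (C eta : R) :
  hyperbolic_pair phi psi L m lam -> 0 < C -> 0 < eta ->
  exists n0, forall n, n0 <= n -> forall p q,
    nrm p <= C * n -> nrm q <= C * n ->
    nrm (Nat.iter J (Nat.iter m psi) p) <= eta * n ->
    nrm (Nat.iter J (Nat.iter m phi) q) <= eta * n ->
    gprod p q one <= 2 * eta * n.
Proof.
intros HP HC Heta.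
set (Lam := L ^ (J * m)).
assert (HLam : 1 <= Lam) by apply (hp_powL_ge1 HP).
assert (Hd := delta_ge0).
destruct (gprod_bilipschitz Lam (eta / 8) C HLam ltac:(lra) HC) as [n1 Hn1].
exists (Rmax n1 ((4 * Lam * delta + 2) / eta)).
intros n Hn p q Hp Hq Hcp Hcq.
assert (Hnn1 := Rle_trans _ _ _ (Rmax_l _ _) Hn).
assert (Hnn2 := Rle_trans _ _ _ (Rmax_r _ _) Hn).
apply (Rmult_le_compat_l eta) in Hnn2; [|lra].
replace (eta * ((4 * Lam * delta + 2) / eta)) with (4 * Lam * delta + 2) in Hnn2
  by (field; lra).
assert (HLd : 0 <= Lam * delta) by (apply Rmult_le_pos; lra).
assert (Hbi : bilipschitz Lam (Nat.iter (J * m) phi) (Nat.iter (J * m) psi))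
  by (apply (bilipschitz_iter HP); lia).
(* The test point [z] lies on a geodesic from [one] to [p], where it starts to part from [q]: its
   norm is the integer part of the Gromov product to be bounded. *)
destruct (INR_floor _ (gprod_ge0 p q one)) as [i Hi].
destruct (geodesic_path one p) as [path [_ [_ [_ [Hpi Hpg]]]]].
specialize (Hpi i); specialize (Hpg i); set (z := path i) in *.
rewrite !dist_one_l in *.
assert (Hip : INR i <= nrm p).
{ destruct Hi as [Hi _]; unfold gromov_prod in Hi.
  rewrite !dist_one_r in Hi.
  assert (H := dist_triangle one p q); rewrite !dist_one_l in H; lra. }
specialize (Hpi Hip).
assert (Hzp : gprod one p z = 0).
{ unfold gromov_prod; rewrite !dist_one_l, (dist_sym p z); lra. }
(* The products of [z] with [p] and of [p] with [q], based at [one], are both at least [INR i], so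
   [z] also follows the direction of [q] up to [delta]. *)
assert (Hzq : gprod one q z <= delta).
{ assert (H : INR i <= gprod z q one + delta).
  { destruct (gprod_four_point z p q one) as [H|H]; [|lra].
    unfold gromov_prod in H at 1; rewrite !dist_one_r in H; lra. }
  unfold gromov_prod in H |- *.
  rewrite !dist_one_r in H; rewrite !dist_one_l, (dist_sym q z); lra. }
(* If [phi] expands [z], compare with [q], which [phi] contracts; if [psi] does, compare with [p].
   In both cases the image of [z] stays near a geodesic from [one] to a short element. *)
assert (Hz : nrm z <= eta * n + 2 * Lam * delta + eta / 4 * n).
{ destruct (hp_exp _ _ _ _ _ HP z) as [H|H].
  - assert (Hx := expand_pow HP z H J).
    assert (H1 : 1 <= lam ^ J)
      by (apply pow_R1_Rle; assert (Hl := hp_lam _ _ _ _ _ HP); lra).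
    assert (H2 := Hn1 n Hnn1 _ _ one q z Hbi ltac:(rewrite dist_one_l; exact Hq)).
    rewrite (hom_one (Nat.iter (J * m) phi)) in H2
      by apply hom_iter, (hp_hom _ _ _ _ _ HP).
    rewrite iter_mul in Hx, Hcq.
    assert (H3 := nrm_le_gprod (Nat.iter (J * m) phi q) (Nat.iter (J * m) phi z)).
    assert (H4 := pos_INR (wordlen mul one inv S z)).
    assert (Lam * gprod one q z <= Lam * delta) by (apply Rmult_le_compat_l; lra).
    nra.
  - assert (Hx := expand_pow (hyperbolic_pair_sym _ _ _ _ _ HP) z H J).
    assert (H1 : 1 <= lam ^ J)
      by (apply pow_R1_Rle; assert (Hl := hp_lam _ _ _ _ _ HP); lra).
    assert (H2 := Hn1 n Hnn1 _ _ one p z (bilipschitz_sym _ _ _ Hbi)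
                    ltac:(rewrite dist_one_l; exact Hp)).
    rewrite (hom_one (Nat.iter (J * m) psi)) in H2
      by apply hom_iter, (hp_hom' _ _ _ _ _ HP).
    rewrite iter_mul in Hx, Hcp.
    assert (H3 := nrm_le_gprod (Nat.iter (J * m) psi p) (Nat.iter (J * m) psi z)).
    assert (H4 := pos_INR (wordlen mul one inv S z)).
    rewrite Hzp in H2.
    nra. }
lra.
Qed.

(** * Almost fixed points of [x -> a phi(x)] *)

(** Applying the [j]-th iterate of [phi] to the near equality of [y] and [a ** phi y] shows that one
    more [phi] lengthens by at most [L ^ j * (nrm a + N)]; the sum is bounded crudely by its largest
    term. *)
Lemma almost_fixed_iter phi psi L m lam a y N j :
  hyperbolic_pair phi psi L m lam -> dist y (a ** phi y) <= N ->
  nrm (Nat.iter j phi y) <= nrm y + INR j * L ^ j * (nrm a + N).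
Proof.
intros HP Hy.
assert (HL := hp_L _ _ _ _ _ HP).
assert (HN : 0 <= N) by (assert (H := dist_ge0 y (a ** phi y)); lra).
assert (Ha := pos_INR (wordlen mul one inv S a)).
induction j as [|j IH]; [simpl; lra|].
assert (Hh : is_hom mul (Nat.iter j phi)) by apply hom_iter, (hp_hom _ _ _ _ _ HP).
destruct (bilipschitz_iter HP j j (le_n j)) as [Hb _].
assert (Hs : nrm (Nat.iter (Datatypes.S j) phi y)
             <= nrm (Nat.iter j phi y) + L ^ j * (nrm a + N)).
{ assert (H1 := Hb one a); rewrite (hom_one _ Hh), !dist_one_l in H1.
  assert (H2 := Hb y (a ** phi y)).
  rewrite Hh, <- Nat.iter_succ_r in H2.
  assert (H3 := dist_triangle (Nat.iter j phi a) one
    (Nat.iter j phi a ** Nat.iter (Datatypes.S j) phi y)).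
  assert (H4 := dist_triangle one (Nat.iter j phi y)
    (Nat.iter j phi a ** Nat.iter (Datatypes.S j) phi y)).
  assert (H5 : dist (Nat.iter j phi a)
    (Nat.iter j phi a ** Nat.iter (Datatypes.S j) phi y)
    = nrm (Nat.iter (Datatypes.S j) phi y)) by (unfold wdist; now gsimp).
  rewrite dist_one_r, dist_one_l in H3; rewrite !dist_one_l in H4.
  assert (L ^ j * dist y (a ** phi y) <= L ^ j * N)
    by (apply Rmult_le_compat_l; [apply pow_le; lra|exact Hy]).
  lra. }
assert (Hm : L ^ j * (nrm a + N) <= L ^ Datatypes.S j * (nrm a + N)).
{ apply Rmult_le_compat_r; [lra|]; apply Rle_pow; [exact HL|lia]. }
assert (Hj := pos_INR j).
rewrite S_INR; rewrite Rmult_assoc in IH |- *.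
assert (INR j * (L ^ j * (nrm a + N)) <= INR j * (L ^ Datatypes.S j * (nrm a + N)))
  by (apply Rmult_le_compat_l; auto).
lra.
Qed.

(* The map [x -> a phi(x)] has inverse [x -> psi(a^-1) psi(x)]. *)
Lemma almost_fixed_inverse phi psi L m lam a y N :
  hyperbolic_pair phi psi L m lam -> dist y (a ** phi y) <= N ->
  dist y (psi (inv a) ** psi y) <= L * N.
Proof.
intros HP Hy.
assert (HL := hp_L _ _ _ _ _ HP).
rewrite <- (hp_can _ _ _ _ _ HP y) at 1.
rewrite <- (hp_hom' _ _ _ _ _ HP), dist_hom by apply (hp_hom' _ _ _ _ _ HP).
eapply Rle_trans; [apply (hp_lip' _ _ _ _ _ HP)|].
apply Rmult_le_compat_l; [lra|].
eapply Rle_trans; [|exact Hy].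
rewrite (dist_sym y); unfold wdist; gsimp; lra.
Qed.

(** One of the two [m]-th iterates multiplies [nrm y] by [lam], whereas [almost_fixed_iter] permits
    only an additive gain. The extra factor [L] pays for replacing [a] by [psi (inv a)] and [N] by
    [L * N] in the second case. *)
Lemma almost_fixed_bound phi psi L m lam a y N :
  hyperbolic_pair phi psi L m lam -> dist y (a ** phi y) <= N ->
  (lam - 1) * nrm y <= INR m * L ^ (m + 1) * (nrm a + N).
Proof.
intros HP Hy.
assert (HL := hp_L _ _ _ _ _ HP).
assert (HN : 0 <= N) by (assert (H := dist_ge0 y (a ** phi y)); lra).
assert (Ha := pos_INR (wordlen mul one inv S a)).
assert (Hm := pos_INR m).
assert (HLm := hp_powL_ge1 HP m).
assert (HmL : 0 <= INR m * L ^ m) by (apply Rmult_le_pos; lra).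
rewrite pow_add, pow_1.
replace (INR m * (L ^ m * L) * (nrm a + N))
  with (INR m * L ^ m * (L * nrm a + L * N)) by ring.
destruct (hp_exp _ _ _ _ _ HP y) as [H|H].
- assert (H1 := almost_fixed_iter phi psi L m lam a y N m HP Hy).
  assert (INR m * L ^ m * (nrm a + N) <= INR m * L ^ m * (L * nrm a + L * N))
    by (apply Rmult_le_compat_l; [exact HmL|nra]).
  lra.
- assert (H1 := almost_fixed_iter psi phi L m lam (psi (inv a)) y (L * N) m
    (hyperbolic_pair_sym _ _ _ _ _ HP)
    (almost_fixed_inverse phi psi L m lam a y N HP Hy)).
  assert (H2 := hp_lip' _ _ _ _ _ HP (inv a)); rewrite nrm_inv in H2.
  assert (INR m * L ^ m * (nrm (psi (inv a)) + L * N)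
          <= INR m * L ^ m * (L * nrm a + L * N))
    by (apply Rmult_le_compat_l; [exact HmL|lra]).
  lra.
Qed.

(* If [y] lies beyond [a] as seen from [1], then, being almost fixed by [x -> a phi(x)],
   it lies beyond all the iterates of [1] under that map. *)
Lemma almost_fixed_beyond phi psi L m lam (K : nat) (C eps : R) :
  hyperbolic_pair phi psi L m lam -> 0 < C -> 0 < eps ->
  exists n0, forall n, n0 <= n -> forall a y N E,
    nrm y <= C * n -> dist y (a ** phi y) <= N -> gprod one y a <= E ->
    nrm (Nat.iter K phi a) - (INR K + 1) * (2 * (L ^ K * E + eps * n) + L ^ K * N)
    <= nrm y.
Proof.
intros HP HC Heps.
destruct (gprod_bilipschitz (L ^ K) eps C (hp_powL_ge1 HP K) Heps HC) as [n0 Hn0].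
exists n0; intros n Hn a y N E Hyn Hy HE.
assert (HLK := hp_powL_ge1 HP K).
set (e := 2 * (L ^ K * E + eps * n) + L ^ K * N).
(* The image of [a] nearly lies between [one] and the image of [y], and its distance to the latter
   is nearly the norm of the next iterate of [y]. *)
assert (Hstep : forall j, (j <= K)%nat ->
  nrm (Nat.iter j phi a) + nrm (Nat.iter (Datatypes.S j) phi y) - e
  <= nrm (Nat.iter j phi y)).
{ intros j Hj.
  assert (Hbi := bilipschitz_iter HP j K Hj).
  assert (Hh : is_hom mul (Nat.iter j phi)) by apply hom_iter, (hp_hom _ _ _ _ _ HP).
  assert (H1 := Hn0 n Hn _ _ one y a Hbi ltac:(rewrite dist_one_l; exact Hyn)).
  rewrite (hom_one _ Hh) in H1.
  destruct Hbi as [Hb _].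
  assert (H2 := Hb y (a ** phi y)).
  rewrite Hh, <- Nat.iter_succ_r in H2.
  assert (H3 := dist_triangle (Nat.iter j phi a) (Nat.iter j phi y)
    (Nat.iter j phi a ** Nat.iter (Datatypes.S j) phi y)).
  assert (H5 : dist (Nat.iter j phi a)
    (Nat.iter j phi a ** Nat.iter (Datatypes.S j) phi y)
    = nrm (Nat.iter (Datatypes.S j) phi y)) by (unfold wdist; now gsimp).
  assert (L ^ K * dist y (a ** phi y) <= L ^ K * N) by (apply Rmult_le_compat_l; lra).
  assert (L ^ K * gprod one y a <= L ^ K * E) by (apply Rmult_le_compat_l; lra).
  unfold gromov_prod in H1 at 1.
  rewrite !dist_one_l, (dist_sym (Nat.iter j phi y) (Nat.iter j phi a)) in H1.
  unfold e; lra. }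
(* Telescoping [Hstep]; the norms of the images of [a] are dropped here, and only the one at [K] is
   kept in the end. *)
assert (Hdec : forall j, (j <= K)%nat -> nrm (Nat.iter j phi y) - INR j * e <= nrm y).
{ induction j as [|j IH]; intros Hj; [simpl; lra|].
  specialize (IH ltac:(lia)); specialize (Hstep j ltac:(lia)).
  rewrite S_INR.
  assert (H := pos_INR (wordlen mul one inv S (Nat.iter j phi a))); lra. }
specialize (Hstep K (le_n K)); specialize (Hdec K (le_n K)).
assert (H := pos_INR (wordlen mul one inv S (Nat.iter (Datatypes.S K) phi y))).
lra.
Qed.

(** * Absence of backtracking, forwards and backwards *)

Lemma nrm_mul_gprod x y : nrm (x ** y) = nrm x + nrm y - 2 * gprod (inv x) y one.
Proof.
unfold gromov_prod; rewrite !dist_one_r, nrm_inv.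
unfold wdist; gsimp; lra.
Qed.

Lemma gprod_prefix x y : gprod (x ** y) x one = nrm x - gprod (inv x) y one.
Proof.
assert (H := nrm_mul_gprod x y).
unfold gromov_prod at 1; rewrite !dist_one_r.
unfold wdist; gsimp; rewrite nrm_inv; lra.
Qed.

Lemma gprod_inv_suffix x y :
  gprod (inv y) (inv (x ** y)) one = nrm y - gprod (inv x) y one.
Proof.
assert (H := nrm_mul_gprod x y).
unfold gromov_prod at 1; rewrite !dist_one_r, !nrm_inv.
unfold wdist; gsimp; rewrite nrm_inv; lra.
Qed.

(** With little cancellation, [inv (x ** y)] sets out along [inv y] and [f (x ** y)] along [f x].
    These two diverge within [E], before either of them ends, so the longer elements diverge there
    too, up to two uses of the four-point condition. *)
Lemma gprod_inv_image_mul f x y E : is_hom mul f ->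
  gprod (inv y) (f x) one <= E -> gprod (inv x) y one <= E ->
  gprod (inv (f x)) (f y) one <= E ->
  2 * E + 2 * delta < nrm y -> 2 * E + 2 * delta < nrm (f x) ->
  gprod (inv (x ** y)) (f (x ** y)) one <= E + 2 * delta.
Proof.
intros Hf H1 H2 H3 H4 H5; assert (Hd := delta_ge0).
assert (H6 := gprod_inv_suffix x y).
assert (H7 := gprod_prefix (f x) (f y)); rewrite <- Hf in H7.
destruct (gprod_four_point (inv y) (inv (x ** y)) (f x) one) as [H|H]; [lra|].
destruct (gprod_four_point (inv (x ** y)) (f (x ** y)) (f x) one); lra.
Qed.

(* The left alternative puts [y] beyond [a] as seen from [1]; the right one is its mirror
   image for [psi], see [almost_fixed_behind]. *)
Lemma almost_fixed_dichotomy (phi : G -> G) a y N E :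
  dist y (a ** phi y) <= N ->
  gprod (inv a) (phi a) one <= E ->
  gprod one y a <= E + delta \/ gprod (phi y) (phi a) one <= E + delta + N.
Proof.
intros Hy HE.
assert (HE' : gprod one (a ** phi a) a <= E).
{ rewrite <- (gprod_mul_l (inv a)); gsimp; exact HE. }
(* In the second case [y] is moved to [a ** phi y] at cost [N], and everything is translated by
   [inv a]. *)
destruct (gprod_four_point one y (a ** phi a) a) as [H|H]; [left; lra|right].
assert (H1 := gprod_move (a ** phi y) y (a ** phi a) a).
rewrite (dist_sym (a ** phi y)) in H1.
rewrite <- (gprod_mul_l (inv a) (a ** phi y)) in H1.
revert H1; gsimp; intros H1; lra.
Qed.

(** Two applications of [psi] turn [phi y] and [phi a] into [psi y] and [psi a]; a translation by
    [psi (inv a)] and [almost_fixed_inverse] then bring in [y]. The result is what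
    [almost_fixed_beyond] requires for [psi] and [psi (inv a)]. *)
Lemma almost_fixed_behind phi psi L m lam (C eps : R) :
  hyperbolic_pair phi psi L m lam -> 0 < C -> 0 < eps ->
  exists n0, forall n, n0 <= n -> forall a y N E,
    nrm y <= C * n -> nrm a <= C * n -> dist y (a ** phi y) <= N ->
    gprod (phi y) (phi a) one <= E ->
    gprod one y (psi (inv a)) <= L ^ 2 * E + eps * n + L * N.
Proof.
intros HP HC Heps.
assert (HL := hp_L _ _ _ _ _ HP).
destruct (gprod_bilipschitz (L ^ 2) eps (2 * L * C) (hp_powL_ge1 HP 2) Heps
  ltac:(nra)) as [n0 Hn0].
exists n0; intros n Hn a y N E Hyn Han Hy HE.
assert (Hbi := bilipschitz_iter (hyperbolic_pair_sym _ _ _ _ _ HP) 2 2 (le_n 2)).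
assert (Hd : dist (phi y) (phi a) <= 2 * L * C * n).
{ assert (H1 := dist_triangle (phi y) one (phi a)).
  rewrite dist_one_l, dist_one_r in H1.
  assert (H2 := hp_lip _ _ _ _ _ HP y); assert (H3 := hp_lip _ _ _ _ _ HP a).
  nra. }
assert (H1 := Hn0 n Hn _ _ _ _ one Hbi Hd).
rewrite (hom_one (Nat.iter 2 psi)) in H1 by apply hom_iter, (hp_hom' _ _ _ _ _ HP).
change (gprod (psi (psi (phi y))) (psi (psi (phi a))) one
        <= L ^ 2 * gprod (phi y) (phi a) one + eps * n) in H1.
rewrite !(hp_can _ _ _ _ _ HP) in H1.
assert (H2 : L ^ 2 * gprod (phi y) (phi a) one <= L ^ 2 * E)
  by (apply Rmult_le_compat_l; [apply pow_le; lra|exact HE]).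
assert (H3 := almost_fixed_inverse phi psi L m lam a y N HP Hy).
rewrite (hom_inv psi a (hp_hom' _ _ _ _ _ HP)) in H3 |- *.
rewrite <- (gprod_mul_l (psi a)), gprod_sym; gsimp.
assert (H4 := gprod_move (psi a ** y) (psi y) (psi a) one).
rewrite <- (dist_mul_l (psi a)) in H3; revert H3; gsimp; intros H3.
lra.
Qed.

(** * The choice of [a = x w] and the contradiction *)

Lemma no_uniform_almost_fixed phi psi L m lam g N :
  hyperbolic_pair phi psi L m lam -> g <> one ->
  ~ (forall a, exists y, dist y (a ** phi y) <= N).
Proof.
intros HP Hg Hfix.
assert (HP' := hyperbolic_pair_sym _ _ _ _ _ HP).
assert (HL := hp_L _ _ _ _ _ HP).
assert (Hlam := hp_lam _ _ _ _ _ HP).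
assert (Hd := delta_ge0).
assert (HN : 0 <= N).
{ destruct (Hfix one) as [y Hy]; eapply Rle_trans; [apply dist_ge0|exact Hy]. }
assert (HLm := hp_powL_ge1 HP m).
(* [almost_fixed_bound] becomes [nrm y <= D * (nrm a + N)], hence at most [(2 * D + 1) * n]. *)
set (D := INR m * L ^ (m + 1) / (lam - 1)).
assert (HD : 0 <= D).
{ apply Rmult_le_pos; [|apply Rlt_le, Rinv_0_lt_compat; lra].
  apply Rmult_le_pos; [apply pos_INR|apply pow_le; lra]. }
(* [L ^ m] makes up for [x] and [w] having norm only [n / L ^ m], the summand 1 for the contracted
   factor of [a], and the outer [L] for passing from [a] to [psi (inv a)]; [2 * D + 4] beats the
   bound on [nrm y] with room for errors. *)
destruct (pow_unbounded lam (L ^ m * (1 + L * (2 * D + 4))) Hlam) as [j Hj].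
set (K := (j * m)%nat).
assert (HLK := hp_powL_ge1 HP K).
set (W := (INR K + 1) * 5 * L ^ K * L ^ 2).
assert (HW : 1 <= W).
{ assert (H := pos_INR K); assert (H1 := hp_powL_ge1 HP 2).
  unfold W.
  assert (1 <= (INR K + 1) * 5) by lra.
  assert (1 <= (INR K + 1) * 5 * L ^ K) by nra.
  nra. }
set (V := W + L ^ m * L).
assert (HLmL : 1 <= L ^ m * L) by nra.
(* After multiplication by [V], the at most four terms [eta * n] of any error amount to at most
   [n / 2]. *)
set (eta := / (8 * V)).
assert (Heta : 0 < eta) by (apply Rinv_0_lt_compat; unfold V; lra).
assert (HetaV : eta * V = / 8) by (unfold eta; field; unfold V; lra).
(* The factor [L] lets [phi x] and [phi w] count as contracted as well. *)
destruct (pow_unbounded lam (L / eta) Hlam) as [J HJ].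
set (JJ := Nat.max j J).
destruct (exists_expanding_scale HP g Hg JJ) as [n1 Hn1].
destruct (exists_expanding_scale HP' g Hg JJ) as [n2 Hn2].
destruct (transverse phi psi L m lam J L eta HP ltac:(lra) Heta) as [n3 Hn3].
destruct (almost_fixed_beyond phi psi L m lam K (2 * D + 2) eta HP ltac:(lra) Heta)
  as [n4 Hn4].
destruct (almost_fixed_beyond psi phi L m lam K (2 * D + 2) eta HP' ltac:(lra) Heta)
  as [n5 Hn5].
destruct (almost_fixed_behind phi psi L m lam (2 * D + 2) eta HP ltac:(lra) Heta)
  as [n6 Hn6].
set (n7 := 8 * V * (3 * delta + N) + D * N + 1).
assert (Hex : exists n,
  n1 <= n /\ n2 <= n /\ n3 <= n /\ n4 <= n /\ n5 <= n /\ n6 <= n /\ n7 <= n).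
{ exists (Rmax n1 (Rmax n2 (Rmax n3 (Rmax n4 (Rmax n5 (Rmax n6 n7)))))).
  repeat split;
  repeat (first [apply Rle_refl | apply Rmax_l | eapply Rle_trans; [|apply Rmax_r]]). }
destruct Hex as [n [Hge1 [Hge2 [Hge3 [Hge4 [Hge5 [Hge6 Hge7]]]]]]].
assert (HDN : 0 <= D * N) by (apply Rmult_le_pos; lra).
assert (HVN : 0 <= V * (3 * delta + N)) by (apply Rmult_le_pos; unfold V; lra).
assert (Hn : 1 <= n) by (unfold n7 in Hge7; lra).
destruct (Hn1 n Hge1) as [x [Hx1 [Hx2 [Hx3 Hx4]]]].
destruct (Hn2 n Hge2) as [w [Hw1 [Hw2 [Hw3 Hw4]]]].
set (a := x ** w).
assert (Hsmall : forall u, lam ^ J * nrm u <= n -> L * nrm u <= eta * n).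
{ intros u Hu; assert (Hu0 := pos_INR (wordlen mul one inv S u)).
  assert (H : L / eta * nrm u <= n).
  { eapply Rle_trans; [|exact Hu]; apply Rmult_le_compat_r; auto. }
  apply (Rmult_le_compat_l eta) in H; [|lra].
  replace (eta * (L / eta * nrm u)) with (L * nrm u) in H by (field; lra).
  exact H. }
assert (Hlarge : forall u, n <= L ^ m * L * nrm u -> 2 * (2 * eta * n) + 2 * delta < nrm u).
{ intros u Hu; apply Rnot_le_lt; intros Hc.
  assert (H : L ^ m * L * nrm u <= V * (4 * eta * n + 2 * delta)).
  { apply Rmult_le_compat; [lra|apply pos_INR|unfold V; lra|lra]. }
  replace (V * (4 * eta * n + 2 * delta))
    with (4 * (eta * V) * n + 2 * (V * delta)) in H by ring.
  rewrite HetaV in H.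
  assert (0 <= V * delta /\ 0 <= V * N)
    by (split; apply Rmult_le_pos; unfold V; lra).
  unfold n7 in Hge7; lra. }
assert (Hpsi : is_hom mul psi) by apply (hp_hom' _ _ _ _ _ HP).
assert (Hphi : is_hom mul phi) by apply (hp_hom _ _ _ _ _ HP).
assert (Hcomm : forall u, psi (phi u) = phi (psi u))
  by (intros u; rewrite (hp_can _ _ _ _ _ HP), (hp_can' _ _ _ _ _ HP); reflexivity).
assert (HcF' : forall u, Nat.iter J (Nat.iter m psi) (phi u)
                         = phi (Nat.iter J (Nat.iter m psi) u))
  by (intros u; rewrite !iter_mul; now apply iter_commute).
assert (HcF : forall u, Nat.iter J (Nat.iter m phi) (phi u)
                        = phi (Nat.iter J (Nat.iter m phi) u))
  by (intros u; rewrite !iter_mul; now apply iter_commute).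
assert (HiF : forall i, is_hom mul (Nat.iter i (Nat.iter m phi)))
  by (intros i; now apply hom_iter, hom_iter).
assert (HiF' : forall i, is_hom mul (Nat.iter i (Nat.iter m psi)))
  by (intros i; now apply hom_iter, hom_iter).
assert (Hxc : L * nrm (Nat.iter J (Nat.iter m psi) x) <= eta * n)
  by (apply Hsmall; eapply Rle_trans; [apply Hx3; unfold JJ; lia|exact Hx2]).
assert (Hwc : L * nrm (Nat.iter J (Nat.iter m phi) w) <= eta * n)
  by (apply Hsmall; eapply Rle_trans; [apply Hw3; unfold JJ; lia|exact Hw2]).
assert (Hxc0 := pos_INR (wordlen mul one inv S (Nat.iter J (Nat.iter m psi) x))).
assert (Hwc0 := pos_INR (wordlen mul one inv S (Nat.iter J (Nat.iter m phi) w))).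
assert (Hx0 := pos_INR (wordlen mul one inv S x)).
assert (Hw0 := pos_INR (wordlen mul one inv S w)).
assert (HLn : n <= L * n) by nra.
assert (Hphix := hp_lip _ _ _ _ _ HP x).
assert (Hphiw := hp_lip _ _ _ _ _ HP w).
assert (HLx : L * nrm x <= L * n) by (apply Rmult_le_compat_l; lra).
assert (HLw : L * nrm w <= L * n) by (apply Rmult_le_compat_l; lra).
(* All three products required pair an element contracted by [psi] ([phi x], [inv x] or
   [inv (phi x)]) with one contracted by [phi] ([inv w], [w] or [phi w]). *)
assert (Ha : gprod (inv a) (phi a) one <= 2 * eta * n + 2 * delta).
{ apply gprod_inv_image_mul; [exact Hphi| | | | |].
  - rewrite gprod_sym; apply (Hn3 n Hge3); rewrite ?nrm_inv; try lra.
    + rewrite HcF'; eapply Rle_trans; [apply (hp_lip _ _ _ _ _ HP)|exact Hxc].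
    + rewrite hom_inv, nrm_inv by apply HiF; nra.
  - apply (Hn3 n Hge3); rewrite ?nrm_inv; try lra.
    + rewrite hom_inv, nrm_inv by apply HiF'; nra.
    + nra.
  - apply (Hn3 n Hge3); rewrite ?nrm_inv; try lra.
    + rewrite hom_inv, nrm_inv by apply HiF'.
      rewrite HcF'; eapply Rle_trans; [apply (hp_lip _ _ _ _ _ HP)|exact Hxc].
    + rewrite HcF; eapply Rle_trans; [apply (hp_lip _ _ _ _ _ HP)|exact Hwc].
  - apply Hlarge; eapply Rle_trans; [exact Hw1|].
    apply Rmult_le_compat_r; [exact Hw0|nra].
  - apply Hlarge; eapply Rle_trans; [exact Hx1|].
    rewrite Rmult_assoc; apply Rmult_le_compat_l; [lra|].
    rewrite <- (hp_can _ _ _ _ _ HP x) at 1; apply (hp_lip' _ _ _ _ _ HP). }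
assert (Hlamj : 1 <= lam ^ j) by (apply pow_R1_Rle; lra).
assert (Hlow : forall u, n <= L ^ m * nrm u ->
  (1 + L * (2 * D + 4)) * n <= lam ^ j * nrm u).
{ intros u Hu; assert (Hu0 := pos_INR (wordlen mul one inv S u)).
  assert (H1 : 0 <= 1 + L * (2 * D + 4)) by nra.
  apply (Rmult_le_compat_l (1 + L * (2 * D + 4))) in Hu; [|exact H1].
  apply (Rmult_le_compat_r (nrm u)) in Hj; [|exact Hu0].
  lra. }
(* The image of [x] is huge, while that of [w] has norm at most [n] and cannot cancel it. *)
assert (HgF : L * (2 * D + 4) * n <= nrm (Nat.iter K phi a)).
{ unfold K, a; rewrite <- iter_mul, HiF.
  assert (H1 := Hx4 j); assert (H2 := Hw3 j ltac:(unfold JJ; lia)).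
  assert (H3 := Hlow x Hx1).
  assert (H4 := pos_INR (wordlen mul one inv S (Nat.iter j (Nat.iter m phi) w))).
  assert (H5 := nrm_mul (Nat.iter j (Nat.iter m phi) x ** Nat.iter j (Nat.iter m phi) w)
                        (inv (Nat.iter j (Nat.iter m phi) w))).
  rewrite nrm_inv, mul_assoc_r, (mul_Vr _ _ _ HG), (mul_1r _ _ _ HG) in H5.
  nra. }
assert (HgF' : L * (2 * D + 4) * n <= nrm (Nat.iter K psi a)).
{ unfold K, a; rewrite <- iter_mul, HiF'.
  assert (H1 := Hw4 j); assert (H2 := Hx3 j ltac:(unfold JJ; lia)).
  assert (H3 := Hlow w Hw1).
  assert (H4 := pos_INR (wordlen mul one inv S (Nat.iter j (Nat.iter m psi) x))).
  assert (H5 := nrm_mul (inv (Nat.iter j (Nat.iter m psi) x))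
    (Nat.iter j (Nat.iter m psi) x ** Nat.iter j (Nat.iter m psi) w)).
  rewrite nrm_inv, mulKg in H5.
  nra. }
destruct (Hfix a) as [y Hy].
assert (Han : nrm a <= 2 * n) by (assert (H := nrm_mul x w); unfold a; lra).
assert (Hyb : nrm y <= (2 * D + 1) * n).
{ assert (H := almost_fixed_bound phi psi L m lam a y N HP Hy).
  assert (H1 : nrm y <= D * (nrm a + N)).
  { apply (Rmult_le_reg_l (lam - 1)); [lra|].
    replace ((lam - 1) * (D * (nrm a + N)))
      with (INR m * L ^ (m + 1) * (nrm a + N)) by (unfold D; field; lra).
    exact H. }
  assert (D * nrm a <= D * (2 * n)) by (apply Rmult_le_compat_l; lra).
  unfold n7 in Hge7; lra. }
assert (Hyn : nrm y <= (2 * D + 2) * n) by lra.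
set (X := 2 * eta * n + 2 * delta + delta).
assert (Hetan : 0 <= eta * n) by (apply Rmult_le_pos; lra).
destruct (total_error_le (INR K + 1) (L ^ K) L X N (eta * n)) as [He1 He2];
  try lra; [assert (H := pos_INR K); lra|unfold X; lra|].
fold W in He1, He2.
assert (HWn : W * (X + N + eta * n) <= n).
{ apply Rle_trans with (V * (X + N + eta * n)).
  { apply Rmult_le_compat_r; [unfold X; lra|unfold V; lra]. }
  replace (V * (X + N + eta * n))
    with (3 * (eta * V) * n + V * (3 * delta + N)) by (unfold X; ring).
  rewrite HetaV; unfold n7 in Hge7; lra. }
assert (HDn : 0 <= D * n) by (apply Rmult_le_pos; lra).
(* In both cases [nrm y] is at least [(2 * D + 4) * n] minus an error of at most [n], against
   [Hyn]. *)
destruct (almost_fixed_dichotomy phi a y N _ Hy Ha) as [Hc|Hc];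
  fold X in Hc.
- assert (H := Hn4 n Hge4 a y N X Hyn Hy Hc).
  assert ((2 * D + 4) * n <= L * (2 * D + 4) * n) by nra.
  lra.
- assert (HanC : nrm a <= (2 * D + 2) * n) by lra.
  assert (Hb := Hn6 n Hge6 a y N _ Hyn HanC Hy Hc).
  assert (H := Hn5 n Hge5 _ y _ _ Hyn
    (almost_fixed_inverse phi psi L m lam a y N HP Hy) Hb).
  assert (Hk : nrm (Nat.iter K psi a) <= L * nrm (Nat.iter K psi (psi (inv a)))).
  { rewrite <- nrm_inv, <- hom_inv by now apply hom_iter.
    rewrite (iter_commute _ psi psi) by reflexivity.
    rewrite <- (hp_can' _ _ _ _ _ HP (Nat.iter K psi (inv a))) at 1.
    apply (hp_lip _ _ _ _ _ HP). }
  assert (Hk' : (2 * D + 4) * n <= nrm (Nat.iter K psi (psi (inv a)))).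
  { apply (Rmult_le_reg_l L); [lra|]; lra. }
  lra.
Qed.

End WordMetric.

Theorem theorem1 (G : Type) (mul : G -> G -> G) (one : G) (inv : G -> G)
  (S : list G) (phi psi : G -> G) :
  is_group mul one inv ->
  generates mul one inv S ->
  gromov_hyperbolic mul one inv S ->
  non_elementary mul one inv ->
  is_hom mul phi ->
  (forall g, psi (phi g) = g) ->
  (forall g, phi (psi g) = g) ->
  hyperbolic_aut mul one inv S phi psi ->
  reidemeister_infinite mul inv phi.
Proof.
intros HG Hgen [delta Hdelta] Hne Hphi Hcan Hcan' [m [lam [_ [Hlam Hexp]]]] [reps Hreps].
(* A trivial group would be virtually cyclic. *)
assert (Hg : exists g, g <> one).
{ apply NNPP; intros Hn; apply Hne.
  exists one, [one]; intros g; exists one; split; [now left|].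
  exists 0%Z; simpl; rewrite (mul_1l _ _ _ HG).
  apply NNPP; intros Hg; apply Hn; exists g; exact Hg. }
destruct Hg as [g Hg].
assert (Hpsi : is_hom mul psi).
{ intros x y; rewrite <- (Hcan' x), <- (Hcan' y) at 1.
  now rewrite <- Hphi, Hcan. }
destruct (lipschitz_constant mul one inv S HG Hgen phi Hphi) as [L1 [HL1 Hlip1]].
destruct (lipschitz_constant mul one inv S HG Hgen psi Hpsi) as [L2 [HL2 Hlip2]].
assert (HP : hyperbolic_pair mul one inv S phi psi (Rmax L1 L2) m lam).
{ split; auto.
  - eapply Rle_trans; [exact HL1|apply Rmax_l].
  - intros h; eapply Rle_trans; [apply Hlip1|].
    apply Rmult_le_compat_r; [apply pos_INR|apply Rmax_l].
  - intros h; eapply Rle_trans; [apply Hlip2|].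
    apply Rmult_le_compat_r; [apply pos_INR|apply Rmax_r].
  - intros h; specialize (Hexp h).
    unfold Rmax in Hexp; destruct (Rle_dec _ _); [right|left]; lra. }
assert (HN : exists N, forall r, In r reps -> INR (wordlen mul one inv S r) <= N).
{ clear. induction reps as [|t T [N HN]]; [exists 0; intros r []|].
  exists (Rmax N (INR (wordlen mul one inv S t))); intros r [<-|Hr]; [apply Rmax_r|].
  eapply Rle_trans; [now apply HN|apply Rmax_l]. }
destruct HN as [N HN].
apply (no_uniform_almost_fixed mul one inv S HG Hgen delta Hdelta
  phi psi _ m lam g N HP Hg).
intros a; destruct (Hreps a) as [r [Hr [gam Er]]].
(* For [y = inv gam], the element [inv y ** (a ** phi y)] is exactly the representative [r]. *)
exists (inv gam).
unfold wdist.
rewrite (inv_inv mul one inv HG), (hom_inv mul one inv HG phi gam Hphi).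
rewrite (mul_assoc _ _ _ HG), <- Er; now apply HN.
Qed.
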